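(* Assume that every finite simple graph $G$ satisfies $q_{list}(G)\le \Delta(G)+1$, where $\Delta(G)$ is the maximum degree of $G$. Let $H=(V,E)$ be a finite linear hypergraph with $n$ vertices. Let $H_3=(V,E_3)$ where $E_3$ is the set of edges of $H$ of rank at least $3$, and let $H_2=(V,E_2)$ where $E_2$ is the set of edges of $H$ of rank exactly $2$. Let $\Delta$ be the maximum degree of $H_3$, and suppose the maximum degree of the graph $H_2$ is at most $n-2\Delta-1$. Then every edge coloring of $H_3$ with colors from a set of $n$ colors can be extended to an edge coloring of $H$ using colors from the same set of $n$ colors.
   Context: A hypergraph $H=(V,E)$ is a finite set $V$ with a set $E$ of subsets of $V$ (edges); the rank of an edge is its cardinality, the degree of a vertex is the number of edges containing it, and $H$ is linear if any two distinct edges share at most one vertex. An edge coloring is a map $\gamma$ from the edges to a set of colors such that $\gamma(e)=\gamma(f)$ for distinct edges $e,f$ only if $e\cap f=\emptyset$. For a graph $G$, $q_{list}(G)$ is the least $k$ such that for every assignment of a list of $k$ colors to each edge of $G$, there is a proper edge coloring of $G$ (adjacent edges receive different colors) in which each edge gets a color from its own list. *)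

(* Defs.v *)
From mathcomp Require Import all_boot.
From mathcomp Require Import boolp.

Set Implicit Arguments.
Unset Strict Implicit.
Unset Printing Implicit Defensive.

(* A hypergraph on the vertex set V is given by its edge set E : {set {set V}}. *)

Section Hypergraph.
Variable V : finType.
Implicit Types E : {set {set V}}.

Definition degree E (v : V) : nat := #|[set e in E | v \in e]|.

Definition max_degree E : nat := \max_(v : V) degree E v.

Definition linear_hypergraph E : Prop :=
  forall e f, e \in E -> f \in E -> e != f -> #|e :&: f| <= 1.

Definition rank_ge3 E : {set {set V}} := [set e in E | 3 <= #|e|].

Definition rank_eq2 E : {set {set V}} := [set e in E | #|e| == 2].

Definition simple_graph E : Prop := forall e, e \in E -> #|e| = 2.

(* Colorings and list assignments have domain [edge E], not [{set V}], so that
   an edgeless hypergraph has a coloring even when there are no colors. *)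
Definition edge E : Type := {e : {set V} | e \in E}.

Definition edge_coloring E (C : Type) (g : edge E -> C) : Prop :=
  forall e f : edge E, e != f -> g e = g f -> [disjoint val e & val f].

Definition extends_coloring E F (C : Type) (g : edge E -> C)
    (g0 : edge F -> C) : Prop :=
  forall (e : edge E) (f : edge F), val e = val f -> g e = g0 f.

Definition edge_choosable E (k : nat) : Prop :=
  forall (C : eqType) (L : edge E -> seq C),
    (forall e, uniq (L e) /\ size (L e) = k) ->
    exists g : edge E -> C, edge_coloring g /\ forall e, g e \in L e.

End Hypergraph.

Lemma distinct_representatives (T C : eqType) (L : T -> seq C) (s : seq T)
    (f0 : T -> C) :
  uniq s -> (forall x, uniq (L x) /\ size s <= size (L x)) ->
  exists f : T -> C, {in s &, injective f} /\ {in s, forall x, f x \in L x}.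
Proof.
elim: s => [|x s IHs] /=; first by exists f0.
case/andP=> xs us HL.
have [|f [finj fL]] := IHs us.
  by move=> y; have [u sz] := HL y; split=> //; apply: ltnW.
have [uL szL] := HL x.
have /hasP[c cL cf] : has (fun c => c \notin map f s) (L x).
  rewrite has_predC; apply/negP => /allP sub.
  by have := uniq_leq_size uL sub; rewrite size_map leqNgt szL.
have neq y : y \in s -> (y == x) = false.
  by move=> ys; apply/negbTE/eqP => yx; rewrite -yx ys in xs.
exists (fun y => if y == x then c else f y); split=> [y z|y]; rewrite !inE.
  case/orP=> [/eqP->|ys] /orP[/eqP->|zs] //; rewrite ?eqxx ?(neq _ ys) ?(neq _ zs).
  - by move=> e; rewrite e map_f in cf.
  - by move=> e; rewrite -e map_f in cf.
  - exact: finj.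
by case/orP=> [/eqP->|ys]; rewrite ?eqxx // (neq _ ys) fL.
Qed.

Lemma edge_choosable_ex (V : finType) (E : {set {set V}}) :
  exists k, `[< edge_choosable E k >].
Proof.
exists #|{: {e : {set V} | e \in E}}|; apply/asboolP => C L HL.
have [f0 _] : exists f0 : edge E -> C, True.
  have F e : 0 < size (L e).
    by have [_ ->] := HL e; apply/card_gt0P; exists e.
  suff h e : {c | c \in L e} by exists (fun e => sval (h e)).
  by case: (L e) (F e) => // c s _; exists c; rewrite mem_head.
have [|f [finj fL]] :=
  @distinct_representatives _ C L (enum {: {e : {set V} | e \in E}}) f0 (enum_uniq _).
  by move=> e; have [u sz] := HL e; rewrite -cardE sz.
exists f; split=> [e g ne eg|e]; last by apply: fL; rewrite mem_enum.
by case/eqP: ne; apply: finj; rewrite ?mem_enum.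
Qed.

(* The list chromatic index. *)
Definition q_list (V : finType) (E : {set {set V}}) : nat :=
  ex_minn (edge_choosable_ex E).

(* Main.v *)
Require Import Defs.
From mathcomp Require Import all_boot.
From mathcomp Require Import boolp.

(** Give each rank 2 edge the list of colors that [g3] does not use on the edges
    meeting it. At most 2 Delta colors are lost, so at least
    n - 2 Delta >= Delta(H_2) + 1 remain, and the list coloring hypothesis colors
    H_2. A vertex then lies on at most Delta(H_2) + Delta < n colored edges, which
    leaves a color for a possible rank 1 edge at that vertex. *)

Set Implicit Arguments.
Unset Strict Implicit.

Section ChoosabilityAndDegrees.
Variable V : finType.
Implicit Types E : {set {set V}}.

(** Longer lists can be cut to their first [k] colors. This turns an upper bound on [q_list] into
    choosability at that bound. *)
Lemma edge_choosable_leq E k m :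
  k <= m -> edge_choosable E k -> edge_choosable E m.
Proof.
move=> le_km chE C L HL.
have [|g [gcol gL]] := chE C (fun e => take k (L e)).
  move=> e; have [uL szL] := HL e; split; first exact: take_uniq.
  by rewrite size_takel // szL.
by exists g; split=> // e; apply: mem_take (gL e).
Qed.

Lemma edge_choosable_q_list E m : q_list E <= m -> edge_choosable E m.
Proof.
move=> le_qm; apply: edge_choosable_leq le_qm _.
by rewrite /q_list; case: ex_minnP => k /asboolP.
Qed.

Lemma degree_leq_max E v : degree E v <= max_degree E.
Proof. exact: (leq_bigmax v). Qed.

(** Union bound over the vertices of [e]: an edge meeting [e] lies in the star of one of them. For
    rank 2 this gives the at most 2 Delta lost colors. *)
Lemma card_edges_meeting E (e : {set V}) :
  #|[set f in E | ~~ [disjoint f & e]]| <= #|e| * max_degree E.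
Proof.
have sub : [set f in E | ~~ [disjoint f & e]]
    \subset \bigcup_(v in e) [set f in E | v \in f].
  apply/subsetP => f; rewrite inE => /andP[fE /pred0Pn[v /andP[vf ve]]].
  by apply/bigcupP; exists v => //; rewrite inE fE.
apply: leq_trans (subset_leq_card sub) _.
rewrite -sum_nat_const.
elim/big_rec2: _ => [|v m A _ IH]; first by rewrite cards0.
apply: leq_trans (leq_card_setU _ _) _.
exact: leq_add (degree_leq_max E v) IH.
Qed.

End ChoosabilityAndDegrees.

Section UnusedColors.
Variables (T C : finType) (h : T -> C).

Lemma card_unused_colors (A : {set T}) : #|C| - #|A| <= #|~: (h @: A)|.
Proof. by rewrite (cardsCs (~: _)) setCK leq_sub2l // leq_imset_card. Qed.

Lemma ex_unused_color (A : {set T}) :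
  #|A| < #|C| -> exists c, {in A, forall x, h x != c}.
Proof.
rewrite -subn_gt0 => /leq_trans/(_ (card_unused_colors A)) /card_gt0P[c].
rewrite inE => cA; exists c => x xA.
by apply: contraNneq cA => <-; apply: imset_f.
Qed.

End UnusedColors.

(** Total functions on [{set V}] let colorings with different edge subtypes be glued by cases on
    rank; the default [c0] is only taken outside [E]. *)
Lemma edge_coloring_total (V : finType) (E : {set {set V}}) (C : Type) (c0 : C)
    (g : edge E -> C) :
  exists h : {set V} -> C, forall e : edge E, h (val e) = g e.
Proof.
exists (fun e => if insub e is Some e' then g e' else c0) => e.
by rewrite valK.
Qed.

Unset Implicit Arguments.
Set Strict Implicit.

Theorem theorem8
  (list_edge_coloring : forall (W : finType) (F : {set {set W}}),
     simple_graph F -> q_list F <= max_degree F + 1)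
  (n : nat) (V : finType) (E : {set {set V}})
  (card_V : #|V| = n)
  (E_linear : linear_hypergraph E)
  (max_degree_E2 :
     max_degree (rank_eq2 E) + 2 * max_degree (rank_ge3 E) + 1 <= n)
  (C : finType) (card_C : #|C| = n)
  (g3 : edge (rank_ge3 E) -> C) (g3_coloring : edge_coloring g3) :
  exists g : edge E -> C, edge_coloring g /\ extends_coloring g g3.
Proof.
set D2 := max_degree (rank_eq2 E) in max_degree_E2.
set D3 := max_degree (rank_ge3 E) in max_degree_E2.
have C_gt0 : 0 < #|C| by rewrite card_C; apply: leq_trans max_degree_E2; rewrite addn1.
have [c0 _] := card_gt0P C_gt0.
have [h3 h3E] := edge_coloring_total c0 g3.
pose free (e : {set V}) := enum (~: (h3 @: [set f in rank_ge3 E | ~~ [disjoint f & e]])).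
have E2_simple : simple_graph (rank_eq2 E).
  by move=> e; rewrite inE => /andP[_ /eqP].
(* Choosability asks for lists of one exact size, so the free colors are truncated to [D2 + 1] of
   them. *)
have [|g2 [g2_coloring g2L]] := edge_choosable_q_list
    (list_edge_coloring _ _ E2_simple) (L := fun e => take (D2 + 1) (free (val e))).
  move=> e; split; first by rewrite take_uniq ?enum_uniq.
  rewrite size_takel // -cardE.
  apply: leq_trans (card_unused_colors _ _).
  rewrite card_C leq_subRL.
    rewrite addnC; apply: leq_trans max_degree_E2; rewrite addnAC leq_add2r leq_add2l.
    by rewrite -(E2_simple _ (valP e)) card_edges_meeting.
  (* Side condition of [leq_subRL]: subtraction is truncated, so the number of lost colors must be
     at most [n]. *)
  apply: leq_trans (card_edges_meeting _ _) _.
  rewrite (E2_simple _ (valP e)); apply: leq_trans max_degree_E2.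
  by rewrite addnAC leq_addl.
have [h2 h2E] := edge_coloring_total c0 g2.
pose h23 (e : {set V}) := if 3 <= #|e| then h3 e else h2 e.
(* A spare color is reserved at every vertex, whether or not its singleton is an edge. *)
have h1_ex v : exists c, forall e, e \in E -> 1 < #|e| -> v \in e -> h23 e != c.
  pose A := [set e in E | (1 < #|e|) && (v \in e)].
  have /(ex_unused_color h23)[c cA] : #|A| < #|C|.
    have sub : A \subset [set e in rank_eq2 E | v \in e]
                     :|: [set e in rank_ge3 E | v \in e].
      apply/subsetP => e; rewrite !inE => /and3P[-> ge2 ->].
      by rewrite !andbT eq_sym -leq_eqVlt.
    rewrite card_C; apply: leq_trans max_degree_E2; rewrite addn1 ltnS.
    apply: leq_trans (subset_leq_card sub) _.
    apply: leq_trans (leq_card_setU _ _) (leq_add (degree_leq_max _ v) _).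
    by apply: leq_trans (degree_leq_max _ v) _; rewrite leq_pmull.
  by exists c => e eE ge2 ve; apply: cA; rewrite inE eE ge2.
have /boolp.choice[h1 h1P] := h1_ex.
(* The empty edge gets [c0], which is harmless since it is disjoint from every edge. *)
pose h (e : {set V}) :=
  if 2 <= #|e| then h23 e else if [pick v in e] is Some v then h1 v else c0.
have h_small (e : {set V}) v : #|e| <= 1 -> v \in e -> h e = h1 v.
  rewrite /h ltnNge => e1 ve; rewrite e1 /=.
  case: pickP => [w we|/(_ v)]; last by rewrite ve.
  by move/card_le1_eqP: e1 => /(_ v w ve we) ->.
(* Ordering the pair by rank removes the symmetric cases. By contraposition, a common vertex [v]
   must force different colors. *)
have h_coloring (e f : {set V}) : e \in E -> f \in E -> #|e| <= #|f| -> e != f ->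
    h e = h f -> [disjoint e & f].
  move=> eE fE le_ef ne_ef; apply: contra_eqT => /pred0Pn[v /andP[/= ve vf]].
  have meet : ~~ [disjoint e & f] by apply/pred0Pn; exists v; rewrite /= ve.
  (* Two edges of rank at most 1 that share [v] both equal the singleton of [v], against
     [e != f]. *)
  have [f1|f2] := leqP #|f| 1.
    have e1 := leq_trans le_ef f1; case/eqP: ne_ef; apply/setP => w.
    apply/idP/idP => [we|wf].
      by move/card_le1_eqP: e1 => /(_ v w ve we) ->.
    by move/card_le1_eqP: f1 => /(_ v w vf wf) ->.
  have [e1|e2] := leqP #|e| 1.
    by rewrite (h_small _ _ e1 ve) /h f2 eq_sym h1P.
  rewrite /h e2 f2 /h23.
  have [f3|f3] := ltnP 2 #|f|; have [e3|e3] := ltnP 2 #|e|.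
  - have eE3 : e \in rank_ge3 E by rewrite inE eE.
    have fE3 : f \in rank_ge3 E by rewrite inE fE.
    apply: contraNneq meet; rewrite (h3E (exist _ e eE3)) (h3E (exist _ f fE3)).
    exact: g3_coloring.
  - have eE2 : e \in rank_eq2 E by rewrite inE eE eqn_leq e3.
    (* The color of [e] comes from [free e], which excludes the color of [f] because [f] meets
       [e]. *)
    have := mem_take (g2L (exist _ e eE2)); rewrite -h2E mem_enum inE /=.
    apply: contraNneq => ->; apply: imset_f.
    by rewrite !inE fE f3 disjoint_sym.
  - by have := leq_trans e3 (leq_trans le_ef f3); rewrite ltnn.
  - have eE2 : e \in rank_eq2 E by rewrite inE eE eqn_leq e3.
    have fE2 : f \in rank_eq2 E by rewrite inE fE eqn_leq f3.
    apply: contraNneq meet; rewrite (h2E (exist _ e eE2)) (h2E (exist _ f fE2)).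
    exact: g2_coloring.
exists (fun e => h (val e)); split=> [e f ne_ef eq_h | e f eq_ef].
  have [le_ef|/ltnW le_fe] := leqP #|val e| #|val f|.
    exact: h_coloring (valP e) (valP f) le_ef ne_ef eq_h.
  rewrite disjoint_sym; apply: h_coloring (valP f) (valP e) le_fe _ (esym eq_h).
  by rewrite eq_sym.
have := valP f; rewrite inE => /andP[_ f3].
by rewrite eq_ef /h (ltnW f3) /h23 f3.
Qed.
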